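(* Fix $\beta>0$. There exists an energy resolution $\sigma_E>0$ such that the following holds. For each $d\ge 1$, let $H=\sum_{i=1}^d X_i$ be the adjacency matrix of the $d$-dimensional hypercube, viewed as a Hamiltonian on $d$ qubits, and let $\mathcal{L}_\beta$ be the CKG Lindbladian of $H$ at inverse temperature $\beta$ with energy resolution $\sigma_E$ and jump operators $A^a=\frac{1}{\sqrt d}Z_a$, $a=1,\dots,d$. Then, as $d\to\infty$, the spectral gap of $\mathcal{L}_\beta$ is $\Omega(d^{-1})$.
   Context: $X_i$ and $Z_i$ denote the Pauli $X$ and $Z$ operators acting on the $i$-th qubit of $(\mathbb{C}^2)^{\otimes d}$; hypercube vertices are bitstrings of length $d$, with edges between strings of Hamming distance 1. CKG Lindbladian. Let $H$ be an $n\times n$ Hermitian matrix, $\beta>0$ an inverse temperature, $\sigma_E>0$ an energy resolution, and $\{A^a\}_{a\in[M]}$ a finite family of $n\times n$ matrices (jump operators), closed under adjoint as a multiset. A Bohr frequency is a difference of two eigenvalues of $H$. For a matrix $A$ and Bohr frequency $\nu$ let $A_\nu=\sum_{E-E'=\nu}P_E A P_{E'}$, where $P_E$ is the spectral projector of $H$ for eigenvalue $E$. Put $\hat f(\omega)=\frac{1}{\sqrt{\sigma_E\sqrt{2\pi}}}\exp\left(-\frac{\omega^2}{4\sigma_E^2}\right)$, $\hat A^a(\omega)=\sum_\nu \hat f(\omega-\nu)A^a_\nu$, $\gamma(\omega)=\exp\left(-\beta\max\left(\omega+\frac{\beta\sigma_E^2}{2},0\right)\right)$, $\theta(\nu_1,\nu_2)=\int_{-\infty}^\infty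 \gamma(\omega)\hat f(\omega-\nu_1)\hat f(\omega-\nu_2)\,d\omega$, and $$B=\sum_{a}\sum_{\nu_1,\nu_2}\frac{\tanh(-\beta(\nu_1-\nu_2)/4)}{2i}\,\theta(\nu_1,\nu_2)\,(A^a_{\nu_2})^\dagger A^a_{\nu_1}.$$ The CKG Lindbladian is $$\mathcal{L}_\beta[X]=-i[B,X]+\sum_{a}\int_{-\infty}^\infty\gamma(\omega)\left(\hat A^a(\omega)X\hat A^a(\omega)^\dagger-\tfrac12\{\hat A^a(\omega)^\dagger\hat A^a(\omega),X\}\right)d\omega .$$ It is self-adjoint for the KMS inner product $\langle X,Y\rangle=\mathrm{Tr}(X^\dagger\rho_\beta^{-1/2}Y\rho_\beta^{-1/2})$, where $\rho_\beta=e^{-\beta H}/\mathrm{Tr}(e^{-\beta H})$, and $\mathcal{L}_\beta[\rho_\beta]=0$. Its spectral gap is $\min_{j>1}|\lambda_j|$, where the eigenvalues are listed with multiplicity and $\lambda_1=0$ is the one with eigenvector $\rho_\beta$. *)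

(* Defs.v *)
From HB Require Import structures.
From mathcomp Require Import all_boot all_order all_algebra all_fingroup.
From mathcomp Require Import complex.
From mathcomp Require Import all_classical all_reals all_analysis.

Set Implicit Arguments.
Unset Strict Implicit.
Unset Printing Implicit Defensive.

Import Order.TTheory GRing.Theory Num.Theory.
Import numFieldNormedType.Exports.

Local Open Scope ring_scope.
Local Open Scope complex_scope.
Local Open Scope sesquilinear_scope.

Section Spectrum.
Variables (R : realType) (n : nat).
Implicit Types (A H : 'M[R[i]]_n) (E nu : R).

(* The eigenvalues, listed with multiplicity (roots of the characteristic
   polynomial). *)
Definition eigenvalues A : seq R[i] :=
  sval (closed_field_poly_normal (char_poly A)).

Lemma char_poly_eigenvalues A :
  char_poly A = \prod_(z <- eigenvalues A) ('X - z%:P).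
Proof.
rewrite /eigenvalues; case: closed_field_poly_normal => s /= {1}->.
by rewrite (monicP (char_poly_monic A)) scale1r.
Qed.

(* Energies and Bohr frequencies are meant for Hermitian [H], whose eigenvalues
   are real. *)
Definition energies H : seq R := undup [seq complex.Re z | z <- eigenvalues H].

Definition bohr_freqs H : seq R :=
  undup [seq E - E' | E <- energies H, E' <- energies H].

Definition spectral_proj H E : 'M[R[i]]_n := proj_ortho (eigenspace H E%:C).

Definition bohr_part H A nu : 'M[R[i]]_n :=
  \sum_(E <- energies H) \sum_(E' <- energies H | E - E' == nu)
    spectral_proj H E *m A *m spectral_proj H E'.

End Spectrum.

Section Integrals.
Variable R : realType.

Definition cintegral (f : R -> R[i]) : R[i] :=
  (\int[lebesgue_measure]_w complex.Re (f w)) +i*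
  (\int[lebesgue_measure]_w complex.Im (f w)).

Definition mxintegral n (F : R -> 'M[R[i]]_n) : 'M[R[i]]_n :=
  \matrix_(i, j) cintegral (fun w => F w i j).

Definition tanh (x : R) : R :=
  (expR x - expR (- x)) / (expR x + expR (- x)).

End Integrals.

Section CKG.
Variables (R : realType) (n M : nat).
Variables (H : 'M[R[i]]_n) (beta sigmaE : R) (A : 'I_M -> 'M[R[i]]_n).
Implicit Types (X : 'M[R[i]]_n) (w nu : R) (a : 'I_M).

Definition filter_ft w : R :=
  (Num.sqrt (sigmaE * Num.sqrt (2 * pi)))^-1 *
  expR (- (w ^+ 2 / (4 * sigmaE ^+ 2))).

Definition gamma w : R :=
  expR (- (beta * Num.max (w + beta * sigmaE ^+ 2 / 2) 0)).

Definition A_hat a w : 'M[R[i]]_n :=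
  \sum_(nu <- bohr_freqs H) (filter_ft (w - nu))%:C *: bohr_part H (A a) nu.

Definition theta nu1 nu2 : R :=
  \int[lebesgue_measure]_w (gamma w * filter_ft (w - nu1) * filter_ft (w - nu2)).

Definition coherent_term : 'M[R[i]]_n :=
  \sum_a \sum_(nu1 <- bohr_freqs H) \sum_(nu2 <- bohr_freqs H)
    ((tanh (- beta * (nu1 - nu2) / 4))%:C / (2 * 'i) * (theta nu1 nu2)%:C) *:
      ((bohr_part H (A a) nu2)^t* *m bohr_part H (A a) nu1).

Definition dissipator_integrand a X w : 'M[R[i]]_n :=
  let Aw := A_hat a w in
  (gamma w)%:C *:
    (Aw *m X *m Aw^t* - 2^-1 *: (Aw^t* *m Aw *m X + X *m (Aw^t* *m Aw))).

Definition ckg_lindbladian X : 'M[R[i]]_n :=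
  - 'i *: (coherent_term *m X - X *m coherent_term) +
  \sum_a mxintegral (dissipator_integrand a X).

Definition adjoint_closed : Prop :=
  exists s : 'S_M, forall a, A (s a) = (A a)^t*.

End CKG.

(* [lin_mx L] is the n^2 x n^2 matrix of [L], so its eigenvalues are those of the
   superoperator. One occurrence of the stationary eigenvalue 0 is dropped; any
   further occurrence is kept and makes the gap 0. The [head] seed is harmless: it
   belongs to the (nonempty, as soon as n > 1) list being minimized. *)
Definition spectral_gap (R : realType) n (L : 'M[R[i]]_n -> 'M[R[i]]_n) : R :=
  let s := [seq Normc.normc z | z <- rem 0 (eigenvalues (lin_mx L))] in
  \big[Num.min/head 0 s]_(r <- s) r.

Section Hypercube.
Variables (R : realType) (d : nat).

(* Computational basis states of d qubits, i.e. bitstrings of length d;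
   [enum_val] below numbers them by matrix indices. *)
Definition bitstring := {ffun 'I_d -> 'I_2}.

Definition pauliX : 'M[R[i]]_2 := \matrix_(s, t) (s != t)%:R.
Definition pauliZ : 'M[R[i]]_2 := \matrix_(s, t) ((-1) ^+ s *+ (s == t)).

(* The tensor product having [P] as i-th factor and the identity elsewhere. *)
Definition on_qubit (i : 'I_d) (P : 'M[R[i]]_2) : 'M[R[i]]_#|bitstring| :=
  \matrix_(x, y) \prod_(k < d)
    (if k == i then P else 1%:M) ((enum_val x : bitstring) k)
                                 ((enum_val y : bitstring) k).

Definition hypercube_ham : 'M[R[i]]_#|bitstring| :=
  \sum_(i < d) on_qubit i pauliX.

Definition hypercube_jump (a : 'I_d) : 'M[R[i]]_#|bitstring| :=
  ((Num.sqrt d%:R)^-1)%:C *: on_qubit a pauliZ.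

Definition hamming (x y : bitstring) : nat := #|[set k | x k != y k]%SET|.

Lemma hypercube_ham_adjacency :
  hypercube_ham = \matrix_(x, y) (hamming (enum_val x) (enum_val y) == 1%N)%:R.
Proof.
apply/matrixP => x y; rewrite summxE mxE /hamming.
under eq_bigr => i _ do rewrite mxE.
set u : bitstring := enum_val x; set v : bitstring := enum_val y.
set D := [set k | u k != v k]%SET.
have fE i : \prod_(k < d) (if k == i then pauliX else 1%:M) (u k) (v k)
            = (D == [set i]%SET)%:R.
  have -> : (D == [set i]%SET) = [forall k, (k \in D) == (k == i)].
    apply/eqP/forallP => [->k|DE]; first by rewrite inE.
    by apply/setP => k; rewrite (eqP (DE k)) inE.
  case: forallP => [DE|].
    apply: big1 => k _; move: (DE k); rewrite inE.
    by case: (k =P i) => [->|_] /eqP; rewrite !mxE; [move=> -> | move/negbFE=> ->].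
  move=> /forallP; rewrite negb_forall => /existsP[k kD].
  rewrite (bigD1 k) //=; apply/eqP; rewrite mulf_eq0; apply/orP; left.
  move: kD; rewrite inE; case: (k =P i) => _; rewrite !mxE;
    by case: (u k == v k).
under eq_bigr => i _ do rewrite fE.
have [/cards1P[i DE]|] := boolP (#|D| == 1%N).
  rewrite (bigD1 i) //= DE eqxx big1 ?addr0 // => j ji.
  by rewrite (inj_eq set1_inj) eq_sym (negbTE ji).
move=> D1; rewrite big1 // => i _; case: eqP => // DE.
by rewrite DE cards1 in D1.
Qed.

Lemma hypercube_ham_hermitian : hypercube_ham ^t* = hypercube_ham.
Proof.
rewrite hypercube_ham_adjacency; apply/matrixP => x y; rewrite !mxE rmorph_nat.
rewrite /hamming; congr (_ == _)%:R.
by apply: eq_card => k; rewrite !inE eq_sym.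
Qed.

Lemma hypercube_jump_adjoint_closed : adjoint_closed hypercube_jump.
Proof.
exists 1%g => a; rewrite perm1; apply/matrixP => x y.
rewrite !mxE rmorphM rmorph_prod /=; congr (_ * _).
  by rewrite /Num.conj /= oppr0.
apply: eq_bigr => k _; case: eqP => _; rewrite !mxE /=; last first.
  by rewrite rmorph_nat eq_sym.
by rewrite rmorphMn rmorphXn rmorphN1 eq_sym; case: eqP => // ->.
Qed.

End Hypercube.

Definition hypercube_lindbladian (R : realType) (beta sigmaE : R) (d : nat) :
    'M[R[i]]_#|bitstring d| -> 'M[R[i]]_#|bitstring d| :=
  ckg_lindbladian (hypercube_ham R d) beta sigmaE (@hypercube_jump R d).
Arguments hypercube_lindbladian {R} beta sigmaE d _.

(* Main.v *)
(* In the eigenbasis of X_a, Z_a is the sum of |+><-| and |-><+|, which shift the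
   energy by 2 and - 2 and have square zero.  The coherent term therefore vanishes,
   and the Lindbladian is (1 / d) times a sum of commuting one-qubit
   superoperators with rates p = theta(2, 2), q = theta(-2, -2) and
   r = theta(2, -2).  Each one-qubit superoperator is diagonalized by 1 + k X
   (k = (p - q) / (p + q)), X, Z and XZ, with eigenvalues 0, - (p + q),
   r - (p + q) / 2 and - r - (p + q) / 2.  Tensor products of these matrices thus
   diagonalize the whole Lindbladian, and its gap is ((p + q) / 2 - r) / d.
   Finally 2 r < p + q, since p + q - 2 r is the integral of a function that is
   positive almost everywhere. *)
From HB Require Import structures.
Require Import Defs.
From mathcomp Require Import all_boot all_order all_algebra complex ring lra.
From mathcomp Require Import all_classical all_reals all_analysis.
From mathcomp Require Import measurable_realfun.
Import Order.TTheory GRing.Theory Num.Theory.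
Import numFieldNormedType.Exports.
Set Implicit Arguments.
Unset Strict Implicit.
Unset Printing Implicit Defensive.
Local Open Scope classical_set_scope.
Local Open Scope ring_scope.
Local Open Scope complex_scope.
Local Open Scope sesquilinear_scope.

(** * Spectra of diagonalized matrices *)

Lemma char_poly_similar (F : fieldType) n (P A D : 'M[F]_n) :
  P \in unitmx -> P *m A = D *m P -> char_poly A = char_poly D.
Proof.
(* Over the polynomials, [P] still intertwines the characteristic matrices, and its determinant is a
   nonzero constant that can be cancelled. *)
rewrite unitmxE unitfE => P0 PA; set Q := map_mx (@polyC F) P.
have eqQ : Q *m char_poly_mx A = char_poly_mx D *m Q.
  by rewrite /char_poly_mx mulmxBr mulmxBl -!map_mxM PA scalar_mxC.
have Q0 : \det Q != 0 by rewrite det_map_mx polyC_eq0.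
apply: (mulfI Q0); rewrite /char_poly -det_mulmx eqQ det_mulmx.
exact: mulrC.
Qed.

Lemma eigenvalues_diag (R : realType) n (P A : 'M[R[i]]_n) (v : 'rV[R[i]]_n) :
  P \in unitmx -> P *m A = diag_mx v *m P ->
  perm_eq (eigenvalues A) [seq v 0 j | j <- enum 'I_n].
Proof.
move=> uP PA; apply: prod_XsubC_eq.
rewrite -char_poly_eigenvalues (char_poly_similar uP PA) char_poly_trig.
  by rewrite big_map big_enum; apply: eq_bigr => i _; rewrite mxE eqxx mulr1n.
exact/diag_mx_is_trig.
Qed.

Lemma scale_real_adjmx (R : realType) m n (x : R) (A : 'M[R[i]]_(m, n)) :
  (x%:C *: A) ^t* = x%:C *: A ^t*.
Proof.
apply/matrixP => i j; rewrite !mxE rmorphM; congr (_ * _).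
exact: conjc_real.
Qed.

Lemma sum_seq_pick (V : nmodType) (T : eqType) (s : seq T) x (v : V) :
  uniq s -> x \in s -> \sum_(y <- s) (if y == x then v else 0) = v.
Proof.
move=> us xs; rewrite (bigD1_seq x) //= eqxx big1 ?addr0 // => y.
by move/negbTE->.
Qed.

(** * Bohr components of a matrix that shifts the energy *)

Section Hermitian.
Variables (R : realType) (n : nat) (H : 'M[R[i]]_n).
Hypothesis hermH : H ^t* = H.

(** In [u *m H *m v ^t*] the Hermitian [H] can act on either factor, giving [a%:C] or [b%:C] times
    the same product. *)
Lemma eigenspace_orthogonal (a b : R) m1 m2
    (u : 'M[R[i]]_(m1, n)) (v : 'M[R[i]]_(m2, n)) :
  a != b -> (u <= eigenspace H a%:C)%MS -> (v <= eigenspace H b%:C)%MS ->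
  u *m v ^t* = 0.
Proof.
move=> ab /eigenspaceP uH /eigenspaceP vH; apply/eqP.
have : (a%:C - b%:C) *: (u *m v ^t*) == 0.
  rewrite scalerBl scalemxAl -uH -mulmxA -{1}hermH.
  rewrite -map_mxM -trmx_mul vH scale_real_adjmx.
  by rewrite -scalemxAr subrr.
by rewrite scaler_eq0 -rmorphB /= fmorph_eq0 subr_eq0 (negbTE ab).
Qed.

Lemma mul_spectral_proj (a b : R) m (u : 'M[R[i]]_(m, n)) :
  (u <= eigenspace H a%:C)%MS ->
  u *m spectral_proj H b = if a == b then u else 0.
Proof.
case: eqVneq => [<-|ab] ua; first exact: proj_ortho_id.
by apply: proj_ortho_0; apply/orthomx1P; exact: eigenspace_orthogonal ab ua _.
Qed.

(** It suffices to test the rows of a unitary matrix diagonalizing [H]: each is an eigenvector, kept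
    by exactly one projector and killed by the others. *)
Lemma sum_spectral_proj : \sum_(E <- energies H) spectral_proj H E = 1%:M.
Proof.
have hsH : H \is hermsymmx.
  by rewrite qualifE /= expr0 scale1r hermH.
set P := spectralmx H; set sp := spectral_diag H.
have uP : P \in unitmx by exact: spectral_unit.
have PH : P *m H = diag_mx sp *m P.
  move/hermitian_normalmx/orthomx_spectralP: hsH => {1}->.
  by rewrite !mulmxA mulmxV // mul1mx.
rewrite -[LHS](mulKmx uP) -[RHS](mulVmx uP); congr (_ *m _).
apply/row_matrixP => i; rewrite row_mul mulmx_sumr.
pose E := complex.Re (sp 0 i).
have spE : sp 0 i = E%:C.
  rewrite RRe_real //.
  by have /mxOverP := hermitian_spectral_diag_real hsH; exact.
have Ei : (row i P <= eigenspace H E%:C)%MS.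
  apply/eigenspaceP; rewrite -row_mul PH row_mul row_diag_mx.
  by rewrite -scalemxAl -rowE spE.
have EH : E \in energies H.
  rewrite mem_undup; apply/mapP; exists (sp 0 i) => //.
  by rewrite (perm_mem (eigenvalues_diag uP PH)) map_f // mem_enum.
under eq_bigr => E' _ do rewrite (mul_spectral_proj E' Ei).
under eq_bigr => E' _ do rewrite eq_sym.
exact: sum_seq_pick (undup_uniq _) EH.
Qed.

(** Eigenvectors are rows here. By the commutation relation, right multiplication by [S] sends those
    of energy [E] to energy [E - nu], which [spectral_proj H E'] keeps or kills. *)
Lemma mul_spectral_proj_shift (S : 'M[R[i]]_n) (nu E E' : R) :
  H *m S - S *m H = nu%:C *: S ->
  spectral_proj H E *m S *m spectral_proj H E' =
    if E - E' == nu then spectral_proj H E *m S else 0.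
Proof.
move=> HS; have -> : (E - E' == nu) = (E - nu == E').
  by rewrite !subr_eq addrC.
apply: mul_spectral_proj; apply/eigenspaceP.
have -> : spectral_proj H E *m S *m H =
    spectral_proj H E *m (H *m S - nu%:C *: S).
  by rewrite -HS opprB addrC subrK mulmxA.
have /eigenspaceP PE : (spectral_proj H E <= eigenspace H E%:C)%MS.
  by rewrite -[X in (X <= _)%MS]mul1mx proj_ortho_sub.
by rewrite mulmxBr mulmxA PE -scalemxAr -scalemxAl -scalerBl rmorphB.
Qed.

(** Only blocks with [E - E' == nu0] survive; inserting the resolution of the identity on both sides
    of [S] recovers [S] from them. *)
Lemma bohr_part_shift (S : 'M[R[i]]_n) (nu0 nu : R) :
  H *m S - S *m H = nu0%:C *: S ->
  bohr_part H S nu = if nu == nu0 then S else 0.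
Proof.
move=> HS; rewrite /bohr_part; case: eqVneq => [->|nunu0]; last first.
  rewrite big1 // => E _; rewrite big1 // => E' /eqP EE'.
  by rewrite (mul_spectral_proj_shift _ _ HS) EE' (negbTE nunu0).
rewrite -[RHS]mul1mx -sum_spectral_proj mulmx_suml; apply: eq_bigr => E _.
rewrite -[RHS]mulmx1 -sum_spectral_proj mulmx_sumr big_mkcond /=.
by apply: eq_bigr => E' _; rewrite (mul_spectral_proj_shift _ _ HS); case: eqP.
Qed.

Lemma bohr_partD (S T : 'M[R[i]]_n) nu :
  bohr_part H (S + T) nu = bohr_part H S nu + bohr_part H T nu.
Proof.
rewrite /bohr_part -big_split; apply: eq_bigr => E _ /=.
by rewrite -big_split; apply: eq_bigr => E' _ /=; rewrite mulmxDr mulmxDl.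
Qed.

Lemma bohr_part_neq0 (S : 'M[R[i]]_n) nu :
  bohr_part H S nu != 0 -> nu \in bohr_freqs H.
Proof.
apply: contraNT => nuH; apply/eqP; rewrite /bohr_part.
rewrite big1_seq // => E /andP[_ EH]; rewrite big1_seq // => E' /andP[/eqP nuE E'H].
by case/negP: nuH; rewrite mem_undup -nuE; apply/allpairsP; exists (E, E').
Qed.

Lemma sum_bohr_part_shift (S : 'M[R[i]]_n) (nu0 : R) (g : R -> R[i]) :
  H *m S - S *m H = nu0%:C *: S ->
  \sum_(nu <- bohr_freqs H) g nu *: bohr_part H S nu = g nu0 *: S.
Proof.
(* When [S] is 0 the relation holds for every [nu0], which need not be a Bohr frequency. *)
move=> HS; have [S0|S0] := eqVneq S 0.
  rewrite S0 scaler0 big1 // => nu _.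
  by rewrite -S0 (bohr_part_shift _ HS) S0 if_same scaler0.
have nu0H : nu0 \in bohr_freqs H.
  by apply: (@bohr_part_neq0 S); rewrite (bohr_part_shift _ HS) eqxx.
under eq_bigr => nu _.
  have -> : g nu *: bohr_part H S nu = if nu == nu0 then g nu0 *: S else 0.
    by rewrite (bohr_part_shift _ HS); case: eqP => [->|_] //; rewrite scaler0.
  over.
exact: sum_seq_pick (undup_uniq _) nu0H.
Qed.

End Hermitian.

(** * Integrability of linear combinations of real functions *)

Section IntegrableEFin.
Variable R : realType.
Local Notation mu := (@lebesgue_measure R).
Implicit Types f g : R -> R.

Lemma integrable_EFinD f g :
  mu.-integrable setT (EFin \o f) -> mu.-integrable setT (EFin \o g) ->
  mu.-integrable setT (EFin \o (fun w => f w + g w)).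
Proof. by move=> fi gi; exact: integrableD fi gi. Qed.

Lemma integrable_EFinB f g :
  mu.-integrable setT (EFin \o f) -> mu.-integrable setT (EFin \o g) ->
  mu.-integrable setT (EFin \o (fun w => f w - g w)).
Proof. by move=> fi gi; exact: integrableB fi gi. Qed.

Lemma integrable_EFinZ (k : R) f : mu.-integrable setT (EFin \o f) ->
  mu.-integrable setT (EFin \o (fun w => k * f w)).
Proof. by move=> fi; exact: integrableZl fi. Qed.

End IntegrableEFin.

(** * The rates [theta]: integrability and strict inequality *)

Section Theta.
Variables (R : realType) (beta sigma : R).
Hypotheses (beta_ge0 : 0 <= beta) (sigma_gt0 : 0 < sigma).
Implicit Types (w nu : R).
Local Notation mu := (@lebesgue_measure R).
Local Notation ff := (filter_ft sigma).
Local Notation gam := (gamma beta sigma).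

Lemma gamma_gt0 w : 0 < gam w.
Proof. exact: expR_gt0. Qed.

Lemma gamma_le1 w : gam w <= 1.
Proof.
by rewrite -expR0 ler_expR oppr_le0 mulr_ge0 // le_max lexx orbT.
Qed.

Lemma gamma_nonincreasing : {homo gam : x y / x <= y >-> y <= x}.
Proof.
move=> x y xy; rewrite ler_expR lerN2 ler_wpM2l //.
rewrite ge_max !le_max lexx orbT andbT; apply/orP; left.
by rewrite lerD2r.
Qed.

Lemma filter_ft_gt0 w : 0 < ff w.
Proof.
rewrite mulr_gt0 ?expR_gt0 // invr_gt0 sqrtr_gt0 mulr_gt0 // sqrtr_gt0.
by rewrite mulr_gt0 // pi_gt0.
Qed.

Lemma ler_filter_ft x y : `|x| <= `|y| -> ff y <= ff x.
Proof.
move=> xy; rewrite ler_wpM2l ?invr_ge0 ?sqrtr_ge0 // ler_expR lerN2.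
rewrite ler_wpM2r ?invr_ge0 ?mulr_ge0 ?exprn_ge0 ?(ltW sigma_gt0) //.
rewrite -[x ^+ 2]real_normK ?num_real // -[y ^+ 2]real_normK ?num_real //.
by rewrite lerXn2r ?nnegrE.
Qed.

Lemma ltr_filter_ft x y : `|x| < `|y| -> ff y < ff x.
Proof.
move=> xy; rewrite ltr_pM2l; last first.
  by rewrite invr_gt0 sqrtr_gt0 mulr_gt0 // sqrtr_gt0 mulr_gt0 // pi_gt0.
rewrite ltr_expR ltrN2 ltr_pM2r ?invr_gt0 ?mulr_gt0 ?exprn_gt0 //.
rewrite -[x ^+ 2]real_normK ?num_real // -[y ^+ 2]real_normK ?num_real //.
by rewrite ltrXn2r ?nnegrE.
Qed.

Lemma measurable_gamma : measurable_fun setT gam.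
Proof.
apply: measurableT_comp => //; apply: measurableT_comp => //.
apply: measurable_funM => //; apply: measurable_maxr => //.
exact: measurable_funD.
Qed.

Lemma measurable_filter_ft nu : measurable_fun setT (fun w => ff (w - nu)).
Proof.
apply: measurable_funM => //; apply: measurableT_comp => //.
apply: measurableT_comp => //; apply: measurable_funM => //.
by apply: measurable_funX; exact: measurable_funB.
Qed.

(** Squaring turns the 4 in the exponent into a 2, which gives a multiple of the normal density of
    mean [nu] and deviation [sigma], known to be integrable. *)
Lemma sqr_filter_ft nu w :
  ff (w - nu) ^+ 2 = ff 0 ^+ 2 / normal_peak sigma * normal_pdf nu sigma w.
Proof.
have s0 : sigma != 0 by rewrite gt_eqF.
rewrite normal_pdfE //; set k := normal_peak sigma; set e := normal_fun _ _ _.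
have k0 : k != 0 by rewrite gt_eqF // normal_peak_gt0.
rewrite mulrA divfK // /filter_ft !exprMn expr0n /= mul0r oppr0 expR0 expr1n mulr1.
congr (_ * _); rewrite -expRM_natl /e /normal_fun; congr expR.
by field.
Qed.

Lemma integrable_filter_ft2 nu :
  mu.-integrable setT (EFin \o (fun w => ff (w - nu) ^+ 2)).
Proof.
under eq_fun do rewrite sqr_filter_ft.
exact: integrableZl (integrable_normal_pdf _ _).
Qed.

(** As [gamma] is at most 1, the integrand is dominated by the sum of the two squared filters. *)
Lemma integrable_theta nu1 nu2 :
  mu.-integrable setT (EFin \o (fun w => gam w * ff (w - nu1) * ff (w - nu2))).
Proof.
apply: (@le_integrable _ _ _ mu setT measurableT _
  (EFin \o (fun w => ff (w - nu1) ^+ 2 + ff (w - nu2) ^+ 2))).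
- apply/measurable_EFinP; apply: measurable_funM.
    apply: measurable_funM; first exact: measurable_gamma.
    exact: measurable_filter_ft.
  exact: measurable_filter_ft.
- move=> w _; rewrite lee_fin /=.
  have := gamma_gt0 w; have := gamma_le1 w.
  have := filter_ft_gt0 (w - nu1); have := filter_ft_gt0 (w - nu2).
  set g := gam w; set a := ff _; set b := ff _ => a0 b0 g1 g0.
  rewrite !ger0_norm ?addr_ge0 ?sqr_ge0 ?mulr_ge0 ?(ltW a0) ?(ltW b0) ?(ltW g0) //.
  have : g * b * a <= b * a by rewrite -mulrA ler_piMl // mulr_ge0 // ltW.
  move/le_trans; apply.
  (* [a ^+ 2 + b ^+ 2 - b * a] is three quarters of the first square plus one quarter of the
     second. *)
  have := sqr_ge0 (a - b); have := sqr_ge0 (a + b); nra.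
- exact: integrableD (integrable_filter_ft2 _) (integrable_filter_ft2 _).
Qed.

Lemma theta_ge0 nu1 nu2 : 0 <= theta beta sigma nu1 nu2.
Proof.
apply: Rintegral_ge0 => w _.
by rewrite !mulr_ge0 ?(ltW (gamma_gt0 _)) ?(ltW (filter_ft_gt0 _)).
Qed.

(* The difference of the two sides is the integral of
   [gamma w * (ff (w - nu) - ff (w + nu)) ^ 2], which is positive off [w = 0]. *)
Lemma theta_gap nu : 0 < nu ->
  2 * theta beta sigma nu (- nu) <
  theta beta sigma nu nu + theta beta sigma (- nu) (- nu).
Proof.
move=> nu0; rewrite -subr_gt0.
pose h w := gam w * (ff (w - nu) - ff (w + nu)) ^+ 2.
have hE w : h w = gam w * ff (w - nu) * ff (w - nu)
    + gam w * ff (w - - nu) * ff (w - - nu)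
    - 2 * (gam w * ff (w - nu) * ff (w - - nu)).
  by rewrite /h opprK; ring.
have ih : mu.-integrable setT (EFin \o h).
  rewrite (funext hE : h = _).
  apply: integrable_EFinB.
    by apply: integrable_EFinD; exact: integrable_theta.
  by apply: integrable_EFinZ; exact: integrable_theta.
have -> : theta beta sigma nu nu + theta beta sigma (- nu) (- nu)
    - 2 * theta beta sigma nu (- nu) = \int[mu]_w h w.
  under [RHS]eq_Rintegral do rewrite hE.
  rewrite RintegralB //; last 2 first.
  - by apply: integrable_EFinD; exact: integrable_theta.
  - by apply: integrable_EFinZ; exact: integrable_theta.
  rewrite RintegralD //; try exact: integrable_theta.
  by rewrite RintegralZl //; exact: integrable_theta.
(* On this interval [w - nu] has absolute value at most [nu / 2], [w + nu] is at least [nu + nu / 2]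
   and [gam w] is at least [gam nu]. So [h] is bounded below by the positive constant [c] on a set
   of measure [nu / 2]. *)
pose I := [set` `[nu / 2, nu]].
pose c := gam nu * (ff (nu / 2) - ff (nu + nu / 2)) ^+ 2.
have c0 : 0 < c.
  rewrite mulr_gt0 ?gamma_gt0 // exprn_gt0 // subr_gt0 ltr_filter_ft //.
  by rewrite !ger0_norm; lra.
have hc w : I w -> c <= h w.
  rewrite /I /= in_itv /= => /andP[w1 w2].
  have d1 : ff (nu / 2) <= ff (w - nu).
    by rewrite ler_filter_ft // ler0_norm ?ger0_norm; lra.
  have d2 : ff (w + nu) <= ff (nu + nu / 2).
    by rewrite ler_filter_ft // !ger0_norm; lra.
  have d3 : ff (nu + nu / 2) < ff (nu / 2).
    by rewrite ltr_filter_ft // !ger0_norm; lra.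
  rewrite /h ler_pM ?sqr_ge0 ?(ltW (gamma_gt0 _)) ?gamma_nonincreasing //.
  by rewrite lerXn2r ?nnegrE; lra.
have mI : measurable I by exact: measurable_itv.
have muI : mu I = (nu / 2)%:E.
  rewrite /I lebesgue_measure_itv /= lte_fin ifT; last by lra.
  by rewrite -EFinB; congr _%:E; lra.
apply: (@lt_le_trans _ _ (\int[mu]_(w in I) c)).
  by rewrite Rintegral_cst //= muI /= mulr_gt0 // divr_gt0.
apply: (@le_trans _ _ (\int[mu]_(w in I) h w)).
  apply: le_Rintegral => //.
    apply/integrableP; split; first exact/measurable_EFinP.
    by rewrite integral_cst //= muI -EFinM ltry.
  exact: integrableS ih.
rewrite Rintegral_mkcond le_Rintegral //.
  rewrite -restrict_EFin; apply/integrable_restrict; rewrite ?setTI //.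
  exact: integrableS ih.
move=> w _; rewrite patchE; case: ifP => // _.
by rewrite mulr_ge0 ?sqr_ge0 // (ltW (gamma_gt0 _)).
Qed.
End Theta.

(** * Integrals of complex combinations of real functions *)

Section ComplexIntegral.
Variable R : realType.
Local Notation mu := (@lebesgue_measure R).
Implicit Types (f g : R -> R) (c : R[i]).

Lemma Re_scale (x : R) c : complex.Re (x%:C * c) = x * complex.Re c.
Proof. by case: c => a b /=; rewrite mul0r subr0. Qed.

Lemma Im_scale (x : R) c : complex.Im (x%:C * c) = x * complex.Im c.
Proof. by case: c => a b /=; rewrite mul0r addr0. Qed.

(** Three terms are needed because an entry of [damping] is a sum of three rates times constant
    complex entries. *)
Lemma cintegral_sum3 f1 f2 f3 c1 c2 c3 :
  mu.-integrable setT (EFin \o f1) -> mu.-integrable setT (EFin \o f2) ->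
  mu.-integrable setT (EFin \o f3) ->
  cintegral (fun w => (f1 w)%:C * c1 + (f2 w)%:C * c2 + (f3 w)%:C * c3) =
  (\int[mu]_w f1 w)%:C * c1 + (\int[mu]_w f2 w)%:C * c2 +
  (\int[mu]_w f3 w)%:C * c3.
Proof.
move=> i1 i2 i3.
have lin (a1 a2 a3 : R) : \int[mu]_w (f1 w * a1 + f2 w * a2 + f3 w * a3) =
    (\int[mu]_w f1 w) * a1 + (\int[mu]_w f2 w) * a2 + (\int[mu]_w f3 w) * a3.
  have iZ f a : mu.-integrable setT (EFin \o f) ->
      mu.-integrable setT (EFin \o (fun w => f w * a)).
    move=> fi; have := integrable_EFinZ a fi.
    by congr (integrable _ _ (_ \o _)); apply/funext => w; rewrite mulrC.
  rewrite RintegralD ?RintegralD ?RintegralZr //; try exact: iZ.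
  by apply: integrable_EFinD; exact: iZ.
have ReIm (z1 z2 : R[i]) : complex.Re z1 = complex.Re z2 ->
    complex.Im z1 = complex.Im z2 -> z1 = z2.
  by case: z1 z2 => ? ? [? ?] /= -> ->.
have ReD (z1 z2 : R[i]) : complex.Re (z1 + z2) = complex.Re z1 + complex.Re z2.
  by case: z1 z2 => ? ? [].
have ImD (z1 z2 : R[i]) : complex.Im (z1 + z2) = complex.Im z1 + complex.Im z2.
  by case: z1 z2 => ? ? [].
apply: ReIm.
  rewrite !ReD !Re_scale -lin; apply: eq_Rintegral => w _.
  by rewrite !ReD !Re_scale.
rewrite !ImD !Im_scale -lin; apply: eq_Rintegral => w _.
by rewrite !ImD !Im_scale.
Qed.

End ComplexIntegral.

(** * The Lindbladian of jumps made of a raising and a lowering part *)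

(** With [Q] the adjoint of [P], the rates [p] and [q] weight the dissipators of the jumps [P] and
    [Q], and [r] weights the interference between the two. Keeping [Q] a separate argument makes the
    later identities purely algebraic. *)
Definition damping (K : fieldType) n (p q r : K) (P Q X : 'M[K]_n) : 'M[K]_n :=
  p *: (P *m X *m Q - 2^-1 *: (Q *m P *m X + X *m (Q *m P))) +
  q *: (Q *m X *m P - 2^-1 *: (P *m Q *m X + X *m (P *m Q))) +
  r *: (P *m X *m P + Q *m X *m Q).

(** [B] stands for the adjoint of [A]. The cross terms of [B *m A] contain [P *m P] or [Q *m Q], so
    interference survives only in the sandwich [A *m X *m B]. *)
Lemma damping_ladder (K : fieldType) n (x y z : K) (P Q X : 'M[K]_n) :
  P *m P = 0 -> Q *m Q = 0 ->
  let A := x *: P + y *: Q in let B := x *: Q + y *: P in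
  z *: (A *m X *m B - 2^-1 *: (B *m A *m X + X *m (B *m A))) =
  damping (z * x * x) (z * y * y) (z * x * y) P Q X.
Proof.
move=> PP QQ A B.
have -> : B *m A = (x * x) *: (Q *m P) + (y * y) *: (P *m Q).
  rewrite mulmxDl !mulmxDr -!scalemxAl -!scalemxAr !scalerA.
  by rewrite PP QQ !scaler0 addr0 add0r.
have -> : A *m X *m B = (x * x) *: (P *m X *m Q) + (x * y) *: (P *m X *m P)
    + (x * y) *: (Q *m X *m Q) + (y * y) *: (Q *m X *m P).
  rewrite !mulmxDl !mulmxDr -!scalemxAl -!scalemxAr !scalerA.
  by rewrite (mulrC y x) !addrA.
rewrite /damping !mulmxDl !mulmxDr -!scalemxAl -!scalemxAr.
by apply/matrixP => k l; rewrite !mxE; ring.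
Qed.

Section LadderJumps.
Variables (R : realType) (n M : nat).
Variables (H : 'M[R[i]]_n) (beta sigma nu : R) (A P : 'I_M -> 'M[R[i]]_n).
Hypotheses (beta_ge0 : 0 <= beta) (sigma_gt0 : 0 < sigma) (nu_gt0 : 0 < nu).
Hypothesis hermH : H ^t* = H.
Hypothesis AE : forall a, A a = P a + (P a)^t*.
Hypothesis shiftP : forall a, H *m P a - P a *m H = nu%:C *: P a.
Hypothesis sqrP : forall a, P a *m P a = 0.

Local Notation Q a := ((P a)^t*).

Let shiftQ a : H *m Q a - Q a *m H = (- nu)%:C *: Q a.
Proof.
have /(congr1 (fun B : 'M[R[i]]_n => B ^t*)) := shiftP a.
rewrite scale_real_adjmx linearB /= map_mxB !trmx_mul !map_mxM hermH => PE.
by rewrite -opprB PE rmorphN scaleNr.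
Qed.

Let sqrQ a : Q a *m Q a = 0.
Proof. by rewrite -map_mxM -trmx_mul sqrP trmx0 map_mx0. Qed.

Lemma A_hat_ladder a w : A_hat H sigma A a w =
  (filter_ft sigma (w - nu))%:C *: P a + (filter_ft sigma (w - - nu))%:C *: Q a.
Proof.
rewrite /A_hat AE.
under eq_bigr => mu _ do rewrite bohr_partD scalerDr.
rewrite big_split /=.
pose f mu := (filter_ft sigma (w - mu))%:C.
rewrite (sum_bohr_part_shift hermH f (shiftP a)).
by rewrite (sum_bohr_part_shift hermH f (shiftQ a)).
Qed.

(* Off the diagonal [nu1 = nu2], where the hyperbolic tangent vanishes, only the
   products [P a *m P a] and [Q a *m Q a] occur. *)
Lemma coherent_term_ladder : coherent_term H beta sigma A = 0.
Proof.
rewrite /coherent_term big1 // => a _; rewrite big1 // => nu1 _.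
rewrite big1 // => nu2 _; have [->|nu12] := eqVneq nu1 nu2.
  by rewrite subrr mulr0 mul0r /tanh oppr0 subrr mul0r !mul0r scale0r.
have nuN : (nu == - nu) = false by rewrite gt_eqF // gtrN.
rewrite AE !bohr_partD !(bohr_part_shift hermH _ (shiftP a)).
rewrite !(bohr_part_shift hermH _ (shiftQ a)).
have adj0 : (0 : 'M[R[i]]_n)^t* = 0 by rewrite trmx0 map_mx0.
have [n1|_] := eqVneq nu1 nu; have [n2|_] := eqVneq nu2 nu.
- by rewrite n1 n2 eqxx in nu12.
- rewrite n1 nuN addr0 add0r; case: eqP => _.
    by rewrite trmxCK sqrP scaler0.
  by rewrite adj0 mul0mx scaler0.
- rewrite n2 nuN addr0 add0r; case: eqP => _.
    by rewrite sqrQ scaler0.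
  by rewrite mulmx0 scaler0.
rewrite !add0r; case: eqP => [n2|_]; last by rewrite adj0 mul0mx scaler0.
case: eqP => [n1|_]; last by rewrite mulmx0 scaler0.
by rewrite n1 n2 eqxx in nu12.
Qed.

(** The integrand is a [damping] whose rates are the integrands of [theta]. The matrices do not
    depend on [w], so integration acts on the rates alone. *)
Lemma ckg_lindbladian_ladder X : ckg_lindbladian H beta sigma A X =
  \sum_a damping (theta beta sigma nu nu)%:C (theta beta sigma (- nu) (- nu))%:C
    (theta beta sigma nu (- nu))%:C (P a) (Q a) X.
Proof.
rewrite /ckg_lindbladian coherent_term_ladder mul0mx mulmx0 subrr scaler0 add0r.
apply: eq_bigr => a _; apply/matrixP => i j.
rewrite [LHS]mxE.
pose g := gamma beta sigma; pose f := filter_ft sigma.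
have DE w : dissipator_integrand H beta sigma A a X w =
    damping (g w * f (w - nu) * f (w - nu))%:C
      (g w * f (w - - nu) * f (w - - nu))%:C
      (g w * f (w - nu) * f (w - - nu))%:C (P a) (Q a) X.
  have CM (b c : R) : (g w * b * c)%:C = (g w)%:C * b%:C * c%:C :> R[i].
    by rewrite !rmorphM.
  rewrite (CM (f (w - nu)) (f (w - nu))) (CM (f (w - - nu)) (f (w - - nu))).
  rewrite (CM (f (w - nu)) (f (w - - nu))).
  rewrite -(damping_ladder _ _ _ _ (sqrP a) (sqrQ a)).
  rewrite /dissipator_integrand A_hat_ladder; cbv zeta.
  have -> (b c : R) : (b%:C *: P a + c%:C *: Q a)^t* = b%:C *: Q a + c%:C *: P a.
    by rewrite linearD /= map_mxD !scale_real_adjmx trmxCK.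
  by [].
have entryE (p q r : R[i]) (D1 D2 D3 : 'M[R[i]]_n) :
    (p *: D1 + q *: D2 + r *: D3) i j = p * D1 i j + q * D2 i j + r * D3 i j.
  by rewrite !mxE.
rewrite /damping entryE -cintegral_sum3; try exact: integrable_theta.
by congr cintegral; apply/funext => w; rewrite DE /damping entryE.
Qed.

End LadderJumps.

(** * Spectrum and gap of a superoperator with a known eigenbasis *)

Section Superoperator.
Variables (R : realType) (n : nat) (L : 'M[R[i]]_n -> 'M[R[i]]_n).
Variables (V U : 'I_n -> 'I_n -> 'M[R[i]]_n) (ev : 'I_n -> 'I_n -> R[i]).
Hypothesis linL : linear L.
Hypothesis eigV : forall i j, L (V i j) = ev i j *: V i j.
Hypothesis dualVU : forall i j k l,
  \sum_a \sum_b V i j a b * U k l a b = ((i, j) == (k, l))%:R.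

(** Flattened, the eigenmatrices [V i j] form the rows of [A]. The dual family provides a right
    inverse, so [A] is invertible and diagonalizes [lin_mx L]. *)
Lemma eigenvalues_superoperator :
  perm_eq (eigenvalues (lin_mx L)) [seq ev p.1 p.2 | p : 'I_n * 'I_n].
Proof.
pose pr (k : 'I_(n * n)) : 'I_n * 'I_n :=
  enum_val (cast_ord (esym (mxvec_cast n n)) k).
have prK i j : pr (mxvec_index i j) = (i, j) by rewrite /pr cast_ordK enum_rankK.
have prI : injective pr.
  apply: (can_inj (g := fun p => mxvec_index p.1 p.2)) => m.
  by case/mxvec_indexP: m => i j; rewrite prK.
pose A := \matrix_(k < n * n) mxvec (V (pr k).1 (pr k).2).
pose B := \matrix_(k < n * n) mxvec (U (pr k).1 (pr k).2).
have AB : A *m B^T = 1%:M.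
  apply/matrixP => k l; case/mxvec_indexP: k => i j; case/mxvec_indexP: l => k l.
  rewrite [LHS]mxE (reindex _ (curry_mxvec_bij _ _)) /=.
  rewrite (eq_bigr (fun p => V i j p.1 p.2 * U k l p.1 p.2)); last first.
    by move=> [a b] _; rewrite !mxE !prK /= !mxvecE.
  rewrite -(pair_bigA _ (fun a b => V i j a b * U k l a b)) /= dualVU mxE.
  by rewrite -!prK (inj_eq prI).
have [uA _] := mulmx1_unit AB.
pose v := \row_k ev (pr k).1 (pr k).2.
pose Ll : {linear 'M[R[i]]_n -> 'M[R[i]]_n} :=
  HB.pack_for {linear 'M[R[i]]_n -> 'M[R[i]]_n} L
    (GRing.isLinear.Build _ _ _ _ L linL).
have AL : A *m lin_mx L = diag_mx v *m A.
  apply/row_matrixP => k; rewrite !row_mul row_diag_mx -scalemxAl -rowE !rowK mxE.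
  by rewrite (mul_vec_lin Ll) /= eigV linearZ.
apply: (perm_trans (eigenvalues_diag uA AL)).
rewrite (eq_map (_ : _ =1 (fun p => ev p.1 p.2) \o pr)); last first.
  by move=> k; rewrite mxE.
rewrite map_comp; apply: perm_map; apply: uniq_perm.
- by rewrite map_inj_uniq ?enum_uniq.
- exact: enum_uniq.
move=> [i j]; rewrite mem_enum inE; apply/mapP.
by exists (mxvec_index i j); rewrite ?mem_enum ?prK.
Qed.

End Superoperator.

(** Up to permutation, the dropped occurrence of 0 may be taken to be the one coming from [i0]. *)
Lemma spectral_gap_ge (R : realType) n (L : 'M[R[i]]_n -> 'M[R[i]]_n)
    (I : finType) (ev : I -> R[i]) (i0 : I) (g : R) :
  perm_eq (eigenvalues (lin_mx L)) [seq ev i | i : I] -> ev i0 = 0 ->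
  (1 < #|I|)%N -> (forall i, i != i0 -> g <= Normc.normc (ev i)) ->
  g <= spectral_gap L.
Proof.
move=> evE ev0 I1 gE; rewrite /spectral_gap.
set s : seq R := [seq Normc.normc z | z <- _].
have sE : perm_eq s [seq Normc.normc (ev i) | i <- rem i0 (enum I)].
  rewrite (map_comp (@Normc.normc R) ev); apply: perm_map.
  have rem0 t u : perm_eq t (0 :: u) -> perm_eq (rem (0 : R[i]) t) u.
    move=> tu; rewrite -(perm_cons 0) -(permPr tu) perm_sym; apply: perm_to_rem.
    by rewrite (perm_mem tu) mem_head.
  apply: rem0; apply: (perm_trans evE); rewrite -ev0 -map_cons.
  by apply: perm_map; apply: perm_to_rem; rewrite mem_enum.
have s_ge : all (fun r => g <= r) s.
  rewrite (perm_all _ sE) all_map; apply/allP => i /=.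
  by rewrite (rem_filter _ (enum_uniq I)) mem_filter => /andP[/= ii0 _]; exact: gE.
(* Nonemptiness makes the seed [head 0 s] an element of the list rather than the default 0, which
   could lie below [g]. *)
have : size s != 0%N.
  rewrite (perm_size sE) size_map size_rem ?mem_enum // -cardE.
  by case: #|I| I1 => [|[]].
case: (s) s_ge => // r t /allP s_ge _; rewrite big_seq.
apply: (big_ind (fun y => g <= y)) => [|y z gy gz|y]; last exact: s_ge.
  by apply: s_ge; rewrite mem_head.
by rewrite le_min gy.
Qed.

(* Stated over an abstract module: in [R[i]] the unification problems raised by
   these rewrites unfold the complex operations. *)
Lemma linear_damping_shape (K : fieldType) (U W : lmodType K) (S : {linear U -> W})
    (h p q r : K) (A1 A2 A3 B1 B2 B3 C1 C2 : U) :
  S (p *: (A1 - h *: (A2 + A3)) + q *: (B1 - h *: (B2 + B3)) + r *: (C1 + C2)) =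
  p *: (S A1 - h *: (S A2 + S A3)) + q *: (S B1 - h *: (S B2 + S B3)) +
  r *: (S C1 + S C2).
Proof.
have SD A B : S (A + B) = S A + S B by exact: linearD.
have SN A : S (- A) = - S A by exact: linearN.
have SZ c A : S (c *: A) = c *: S A by exact: linearZ.
by rewrite !(SD, SZ, SN).
Qed.

(** * Tensor products of one-qubit matrices *)

Section TensorProduct.
Variables (R : realType) (d : nat).
Local Notation C := R[i].
Implicit Types (V W : 'I_d -> 'M[C]_2) (B : 'M[C]_2) (a : 'I_d).

Definition tens V : 'M[C]_#|bitstring d| :=
  \matrix_(x, y) \prod_(k < d) V k ((enum_val x : bitstring d) k)
                                   ((enum_val y : bitstring d) k).

Definition with_site V a B : 'I_d -> 'M[C]_2 := fun k => if k == a then B else V k.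

Definition site_tens V a B := tens (with_site V a B).

(** Distributivity, the common source of the product rule [tensM] and of the factorized pairing
    [tens_dot]. *)
Lemma sum_prod_bitstring (F : 'I_d -> 'I_2 -> C) :
  \sum_(x < #|bitstring d|) \prod_k F k ((enum_val x : bitstring d) k) =
  \prod_k \sum_s F k s.
Proof. by rewrite bigA_distr_bigA [RHS]big_enum_val. Qed.

Lemma eq_tens V W : V =1 W -> tens V = tens W.
Proof.
by move=> VW; apply/matrixP => x y; rewrite !mxE; apply: eq_bigr => k _; rewrite VW.
Qed.

Lemma tensM V W : tens V *m tens W = tens (fun k => V k *m W k).
Proof.
apply/matrixP => x y; rewrite !mxE.
under eq_bigr => z _ do rewrite !mxE -big_split /=.
rewrite (sum_prod_bitstring (fun k s => V k ((enum_val x : bitstring d) k) s *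
   W k s ((enum_val y : bitstring d) k))).
by apply: eq_bigr => k _; rewrite mxE.
Qed.

Lemma tens_dot V W : \sum_x \sum_y tens V x y * tens W x y =
  \prod_k \sum_s \sum_t V k s t * W k s t.
Proof.
rewrite -(sum_prod_bitstring (fun k s => \sum_t V k s t * W k s t)).
apply: eq_bigr => x _.
rewrite -(sum_prod_bitstring (fun k t => V k ((enum_val x : bitstring d) k) t *
  W k ((enum_val x : bitstring d) k) t)).
by apply: eq_bigr => y _; rewrite !mxE -big_split.
Qed.

Lemma site_tensE V a B x y : site_tens V a B x y =
  B ((enum_val x : bitstring d) a) ((enum_val y : bitstring d) a) *
  \prod_(k < d | k != a) V k ((enum_val x : bitstring d) k)
                             ((enum_val y : bitstring d) k).
Proof.
rewrite mxE (bigD1 a) //= /with_site eqxx; congr (_ * _).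
by apply: eq_bigr => k /negbTE->.
Qed.

Lemma site_tens_is_linear V a : linear (site_tens V a).
Proof.
move=> c A B; apply/matrixP => x y.
rewrite [RHS]mxE [X in _ = X + _]mxE !site_tensE !mxE; ring.
Qed.

HB.instance Definition _ V a :=
  GRing.isLinear.Build C 'M[C]_2 'M[C]_#|bitstring d| _
    (site_tens V a) (site_tens_is_linear V a).

Lemma on_qubitE a B : on_qubit a B = site_tens (fun=> 1%:M) a B.
Proof. by []. Qed.

Lemma on_qubit_is_linear a : linear (@on_qubit R d a).
Proof. exact: site_tens_is_linear. Qed.

HB.instance Definition _ a :=
  GRing.isLinear.Build C 'M[C]_2 'M[C]_#|bitstring d| _
    (@on_qubit R d a) (on_qubit_is_linear a).

Lemma on_qubit_tens a B V : on_qubit a B *m tens V = site_tens V a (B *m V a).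
Proof.
rewrite on_qubitE tensM; apply: eq_tens => k; rewrite /with_site.
by case: eqP => [->|_] //; rewrite mul1mx.
Qed.

Lemma tens_on_qubit a B V : tens V *m on_qubit a B = site_tens V a (V a *m B).
Proof.
rewrite on_qubitE tensM; apply: eq_tens => k; rewrite /with_site.
by case: eqP => [->|_] //; rewrite mulmx1.
Qed.

Lemma with_site_same V a B : with_site V a B a = B.
Proof. by rewrite /with_site eqxx. Qed.

Lemma with_site_twice V a A B : with_site (with_site V a A) a B =1 with_site V a B.
Proof. by move=> k; rewrite /with_site; case: eqP. Qed.

Lemma site_tens_same V a : site_tens V a (V a) = tens V.
Proof. by apply: eq_tens => k; rewrite /with_site; case: eqP => [->|]. Qed.

Lemma on_qubit_site a A B V :
  on_qubit a B *m site_tens V a A = site_tens V a (B *m A).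
Proof.
by rewrite on_qubit_tens with_site_same; apply: eq_tens; exact: with_site_twice.
Qed.

Lemma site_on_qubit a A B V :
  site_tens V a A *m on_qubit a B = site_tens V a (A *m B).
Proof.
by rewrite tens_on_qubit with_site_same; apply: eq_tens; exact: with_site_twice.
Qed.

Lemma on_qubitM a A B : on_qubit a A *m on_qubit a B = on_qubit a (A *m B).
Proof. exact: on_qubit_site. Qed.

Lemma on_qubit_commute a b A B : a != b ->
  on_qubit a A *m on_qubit b B = on_qubit b B *m on_qubit a A.
Proof.
move=> ab; rewrite !on_qubitE !tensM; apply: eq_tens => k; rewrite /with_site.
have [->|_] := eqVneq k a; last by rewrite mulmx1 mul1mx.
by rewrite (negbTE ab) mulmx1 mul1mx.
Qed.

Lemma on_qubit_adj a B : (on_qubit a B)^t* = on_qubit a (B^t*).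
Proof.
apply/matrixP => x y; rewrite !on_qubitE ![in LHS]mxE [in RHS]mxE rmorph_prod.
apply: eq_bigr => k _; rewrite /with_site; case: eqP => _; rewrite !mxE //.
by rewrite rmorph_nat eq_sym.
Qed.

(** Every product involved changes only the factor at site [a], in which the tensor product is
    linear. *)
Lemma damping_on_qubit (p q r : C) a (P Q : 'M[C]_2) V :
  damping p q r (on_qubit a P) (on_qubit a Q) (tens V) =
  site_tens V a (damping p q r P Q (V a)).
Proof.
rewrite -(site_tens_same V a) /damping !on_qubitM !on_qubit_site !site_on_qubit.
exact/esym/(linear_damping_shape (site_tens V a)).
Qed.

End TensorProduct.

(** * Diagonalization of the one-qubit superoperator *)

Section Qubit.
Variable K : numFieldType.
Implicit Types (a b c e p q r : K) (s t : 'I_2).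

Definition mx2 a b c e : 'M[K]_2 := \matrix_(i, j)
  (if i == 0 then if j == 0 then a else b else if j == 0 then c else e).

Lemma mx2M a b c e a' b' c' e' : mx2 a b c e *m mx2 a' b' c' e' =
  mx2 (a * a' + b * c') (a * b' + b * e') (c * a' + e * c') (c * b' + e * e').
Proof.
apply/matrixP => i j; rewrite !mxE big_ord_recl big_ord1 !mxE /=.
by case: (i == 0); case: (j == 0).
Qed.

Lemma mx2D a b c e a' b' c' e' :
  mx2 a b c e + mx2 a' b' c' e' = mx2 (a + a') (b + b') (c + c') (e + e').
Proof. by apply/matrixP => i j; rewrite !mxE; case: (i == 0); case: (j == 0). Qed.

Lemma mx2N a b c e : - mx2 a b c e = mx2 (- a) (- b) (- c) (- e).
Proof. by apply/matrixP => i j; rewrite !mxE; case: (i == 0); case: (j == 0). Qed.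

Lemma mx2Z k a b c e : k *: mx2 a b c e = mx2 (k * a) (k * b) (k * c) (k * e).
Proof. by apply/matrixP => i j; rewrite !mxE; case: (i == 0); case: (j == 0). Qed.

Lemma mx2_dot a b c e a' b' c' e' :
  \sum_i \sum_j mx2 a b c e i j * mx2 a' b' c' e' i j =
  a * a' + b * b' + c * c' + e * e'.
Proof. by rewrite !big_ord_recl !big_ord0 !mxE /= !addr0 !addrA. Qed.

(* |+><-| and |-><+|, which raise and lower the energy of the Pauli X operator
   by 2. *)
Definition raising : 'M[K]_2 := mx2 2^-1 (- 2^-1) 2^-1 (- 2^-1).
Definition lowering : 'M[K]_2 := mx2 2^-1 2^-1 (- 2^-1) (- 2^-1).

(* 1 + k X, X, Z and XZ. *)
Definition qubit_eigmx (k : K) s t : 'M[K]_2 :=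
  if s == 0 then if t == 0 then mx2 1 k k 1 else mx2 0 1 1 0
  else if t == 0 then mx2 1 0 0 (-1) else mx2 0 (-1) 1 0.

(** Dual for the entrywise pairing, without conjugation. The entries [- (k / 2)] cancel the overlap
    of X with 1 + [k] X. *)
Definition qubit_dual (k : K) s t : 'M[K]_2 :=
  if s == 0 then
    if t == 0 then mx2 2^-1 0 0 2^-1 else mx2 (- (k / 2)) 2^-1 2^-1 (- (k / 2))
  else if t == 0 then mx2 2^-1 0 0 (- 2^-1) else mx2 0 (- 2^-1) 2^-1 0.

Definition qubit_eigval p q r s t : K :=
  if s == 0 then if t == 0 then 0 else - (p + q)
  else if t == 0 then r - (p + q) / 2 else - r - (p + q) / 2.

(** The value of [k] puts the populations of |+> and |-> in the ratio [p] to [q], which balances the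
    jumps up and down. The [r] term exchanges [raising] and [lowering], hence acts with opposite
    signs on their sum Z and their difference XZ. *)
Lemma damping_qubit p q r s t : p + q != 0 ->
  let V := qubit_eigmx ((p - q) / (p + q)) s t in
  damping p q r raising lowering V = qubit_eigval p q r s t *: V.
Proof.
move=> pq; rewrite /qubit_eigmx /qubit_eigval /damping /raising /lowering.
case: (s == 0); case: (t == 0) => /=;
  rewrite !(mx2M, mx2D, mx2Z, mx2N); congr mx2; by field.
Qed.

Lemma qubit_eigmx_dual k s t s' t' :
  \sum_i \sum_j qubit_eigmx k s t i j * qubit_dual k s' t' i j =
  ((s, t) == (s', t'))%:R.
Proof.
(* With equality in ['I_2] reduced to tests against 0, four booleans decide both sides. *)
have eq2 (u v : 'I_2) : (u == v) = ((u == 0) == (v == 0)).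
  by case: u v => [[|[|u]] hu] [[|[|v]] hv].
rewrite xpair_eqE (eq2 s) (eq2 t) /qubit_eigmx /qubit_dual.
by case: (s == 0); case: (t == 0); case: (s' == 0); case: (t' == 0);
  rewrite mx2_dot /=; field.
Qed.

End Qubit.

Section Pauli.
Variable R : realType.

Lemma pauliXE : pauliX R = mx2 0 1 1 0.
Proof.
by apply/matrixP => i j; rewrite !mxE; case: i j => [[|[|i]] hi] [[|[|j]] hj].
Qed.

Lemma pauliZE : pauliZ R = raising _ + lowering _.
Proof.
rewrite /raising /lowering mx2D; apply/matrixP => i j; rewrite !mxE.
by case: i j => [[|[|i]] hi] [[|[|j]] hj] //=;
  rewrite ?expr1 ?expr0 ?mulr1n ?mulr0n; field.
Qed.

Lemma raising_adj : (raising R[i])^t* = lowering _.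
Proof.
have c2 : Num.conj (2^-1 : R[i]) = 2^-1 by rewrite fmorphV rmorph_nat.
apply/matrixP => i j; rewrite !mxE.
by case: (i == 0); case: (j == 0); rewrite ?rmorphN /= c2.
Qed.

Lemma pauliX_raising :
  pauliX R *m raising _ - raising _ *m pauliX R = 2 *: raising _.
Proof.
rewrite pauliXE /raising !(mx2M, mx2N, mx2D, mx2Z).
by congr mx2; field.
Qed.

Lemma raising_sqr : raising R[i] *m raising _ = 0.
Proof.
rewrite /raising mx2M; apply/matrixP => i j; rewrite !mxE.
by case: (i == 0); case: (j == 0); field.
Qed.

End Pauli.


(** * Linearity and scaling of [damping] *)

Section Damping.
Variables (K : fieldType) (n : nat).
Implicit Types (p q r c : K) (P Q X : 'M[K]_n).

Lemma damping_is_linear p q r P Q : linear (damping p q r P Q).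
Proof.
move=> c X Y; rewrite /damping !mulmxDl !mulmxDr -!scalemxAl -!scalemxAr !mulmxDl.
rewrite -!scalemxAl.
by apply/matrixP => i j; rewrite !mxE; ring.
Qed.

(** This is where the normalization of the jumps by the square root of [d] becomes the factor
    [1 / d] of the Lindbladian. *)
Lemma dampingZ p q r c P Q X :
  damping p q r (c *: P) (c *: Q) X = (c * c) *: damping p q r P Q X.
Proof.
rewrite /damping; do ![rewrite -!scalemxAl|rewrite -!scalemxAr]; rewrite !scalerA.
by apply/matrixP => i j; rewrite !mxE; ring.
Qed.

End Damping.

Lemma normc_real (R : realType) (x : R) : Normc.normc x%:C = `|x|.
Proof. by rewrite /= expr0n /= addr0 sqrtr_sqr. Qed.

(** * Spectrum of the hypercube Lindbladian *)

Section Hypercube.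
Variables (R : realType) (d : nat).
Local Notation C := R[i].
Local Notation up a := (on_qubit a (raising C)).
Local Notation down a := (on_qubit a (lowering C)).
Implicit Types (a : 'I_d).

Let c : R := (Num.sqrt d%:R)^-1.

Lemma up_adj a : (up a)^t* = down a.
Proof. by rewrite on_qubit_adj raising_adj. Qed.

Lemma hypercube_jump_ladder a :
  hypercube_jump R a = c%:C *: up a + (c%:C *: up a)^t*.
Proof.
rewrite scale_real_adjmx up_adj -scalerDr; congr (_ *: _).
by rewrite pauliZE; exact: linearD.
Qed.

(** The terms of the Hamiltonian at sites other than [a] commute with [up a], so the one-qubit
    relation decides. *)
Lemma hypercube_ham_up a : let H := hypercube_ham R d in
  H *m (c%:C *: up a) - (c%:C *: up a) *m H = 2%:C *: (c%:C *: up a).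
Proof.
move=> H; rewrite -scalemxAl -scalemxAr -scalerBr scalerA mulrC -scalerA.
congr (_ *: _); rewrite /H /hypercube_ham mulmx_suml mulmx_sumr -sumrB.
rewrite (bigD1 a) //= big1 ?addr0; last first.
  by move=> k ka; rewrite (on_qubit_commute _ _ ka) subrr.
rewrite !on_qubitM.
have -> : (2 : R)%:C = 2 by rewrite rmorph_nat.
have <- : on_qubit a (2 *: raising C) = 2 *: up a by exact: linearZ.
by rewrite -pauliX_raising; apply/esym; exact: linearB.
Qed.

Lemma up_sqr a : (c%:C *: up a) *m (c%:C *: up a) = 0.
Proof.
rewrite -scalemxAl -scalemxAr on_qubitM raising_sqr.
have -> : on_qubit a (0 : 'M[C]_2) = 0 by exact: linear0.
by rewrite !scaler0.
Qed.

Section Spectrum.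
Variables (beta sigma : R).
Hypotheses (beta_ge0 : 0 <= beta) (sigma_gt0 : 0 < sigma).
Let p := theta beta sigma 2 2.
Let q := theta beta sigma (- 2) (- 2).
Let r := theta beta sigma 2 (- 2).

Lemma hypercube_lindbladianE X : hypercube_lindbladian beta sigma d X =
  \sum_a (d%:R^-1)%:C *: damping p%:C q%:C r%:C (up a) (down a) X.
Proof.
have nu0 : 0 < 2 :> R by [].
rewrite /hypercube_lindbladian (ckg_lindbladian_ladder beta_ge0 sigma_gt0 nu0
  (hypercube_ham_hermitian R d) hypercube_jump_ladder hypercube_ham_up up_sqr).
apply: eq_bigr => a _; rewrite scale_real_adjmx up_adj dampingZ.
by rewrite -rmorphM -invfM -expr2 sqr_sqrtr.
Qed.

Lemma hypercube_lindbladian_is_linear :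
  linear (@hypercube_lindbladian R beta sigma d).
Proof.
move=> k X Y; rewrite !hypercube_lindbladianE scaler_sumr -big_split.
apply: eq_bigr => a _; rewrite (damping_is_linear p%:C q%:C r%:C).
have scale_comb (W : lmodType C) (b e : C) (u v : W) :
  b *: (e *: u + v) = e *: (b *: u) + b *: v.
  by rewrite scalerDr !scalerA mulrC.
exact: scale_comb.
Qed.

Let k0 : C := (p%:C - q%:C) / (p%:C + q%:C).

Let gap := (p + q) / 2 - r.

Lemma gap_gt0 : 0 < gap.
Proof.
by have := theta_gap beta_ge0 sigma_gt0 (ltr0n R 2); rewrite -/p -/q -/r /gap; lra.
Qed.

(** At site [k] the pair [(x k, y k)] selects one of the four one-qubit eigenmatrices, so pairs of
    bitstrings index the eigenbasis. *)
Let V (x y : bitstring d) := tens (fun k => qubit_eigmx k0 (x k) (y k)).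
Let U (x y : bitstring d) := tens (fun k => qubit_dual k0 (x k) (y k)).
Let ev (x y : bitstring d) : R := d%:R^-1 * \sum_k qubit_eigval p q r (x k) (y k).

(** [r - (p + q) / 2] is exactly [- gap]; the other two nonzero eigenvalues lie no higher because
    [r] is nonnegative. *)
Lemma qubit_eigval_le_gap (s t : 'I_2) :
  (s, t) != (0, 0) -> qubit_eigval p q r s t <= - gap.
Proof.
have := theta_ge0 beta sigma 2 (- 2).
have := gap_gt0; rewrite -/r /gap /qubit_eigval xpair_eqE.
by case: (s == 0); case: (t == 0) => //= ? ? _; lra.
Qed.

Lemma hypercube_eig x y :
  hypercube_lindbladian beta sigma d (V x y) = (ev x y)%:C *: V x y.
Proof.
(* Positivity of [gap] gives [p + q > 2 * r], and [r] is nonnegative. *)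
have pq : p%:C + q%:C != 0 :> C.
  rewrite -rmorphD fmorph_eq0 gt_eqF //.
  have := theta_ge0 beta sigma 2 (- 2).
  by have := gap_gt0; rewrite -/r /gap; lra.
rewrite hypercube_lindbladianE /ev rmorphM rmorph_sum.
rewrite -scalerA scaler_suml scaler_sumr.
apply: eq_bigr => a _; congr (_ *: _).
rewrite damping_on_qubit (damping_qubit _ _ _ pq).
have -> : qubit_eigval p%:C q%:C r%:C (x a) (y a) =
    (qubit_eigval p q r (x a) (y a))%:C :> C.
  rewrite /qubit_eigval; case: (x a == 0); case: (y a == 0);
  by rewrite ?rmorph0 ?(rmorphB, rmorphD, rmorphN, rmorphM, fmorphV, rmorph_nat).
transitivity ((qubit_eigval p q r (x a) (y a))%:C *:
    site_tens (fun k => qubit_eigmx k0 (x k) (y k)) a (qubit_eigmx k0 (x a) (y a))).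
  exact: linearZ.
by rewrite site_tens_same.
Qed.

(** The pairing factorizes over sites, and a single site where the indices differ contributes a
    factor 0. *)
Lemma hypercube_dual x y x' y' :
  \sum_i \sum_j V x y i j * U x' y' i j = ((x, y) == (x', y'))%:R.
Proof.
rewrite tens_dot; under eq_bigr => k _ do rewrite qubit_eigmx_dual.
have [/eqP[-> ->]|neq] := boolP ((x, y) == (x', y')).
  by apply: big1 => k _; rewrite eqxx.
have [k kP] : exists k, (x k, y k) != (x' k, y' k).
  apply/existsP; apply: contraR neq; rewrite negb_exists => /forallP xy.
  by apply/eqP; congr pair; apply/ffunP => k; have /negPn/eqP[] := xy k.
by rewrite (bigD1 k) //= (negbTE kP) mul0r.
Qed.

(** All one-qubit eigenvalues are at most 0, and an index other than the stationary one has a site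
    contributing at most [- gap]. *)
Lemma hypercube_spectral_gap : (0 < d)%N ->
  gap / d%:R <= spectral_gap (hypercube_lindbladian beta sigma d).
Proof.
move=> d0.
pose N := #|bitstring d|.
pose e (i : 'I_N * 'I_N) : C := (ev (enum_val i.1) (enum_val i.2))%:C.
have eE : perm_eq (eigenvalues (lin_mx (hypercube_lindbladian beta sigma d)))
    [seq e i | i : 'I_N * 'I_N].
  apply: (@eigenvalues_superoperator _ _ _
    (fun i j => V (enum_val i) (enum_val j))
    (fun i j => U (enum_val i) (enum_val j))
    (fun i j => (ev (enum_val i) (enum_val j))%:C)).
  - exact: hypercube_lindbladian_is_linear.
  - by move=> i j; exact: hypercube_eig.
  - by move=> i j k l; rewrite hypercube_dual !xpair_eqE !(inj_eq enum_val_inj).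
pose z : bitstring d := [ffun=> 0]; pose i0 := (enum_rank z, enum_rank z).
apply: (spectral_gap_ge eE (i0 := i0)).
- by rewrite /e /ev !enum_rankK big1 ?mulr0 // => k _; rewrite !ffunE.
- rewrite card_prod !card_ord /N card_ffun !card_ord.
  by rewrite -expnD (leq_trans _ (leq_pexp2l _ (leq_addr d d))) //
    -[2%N in X in (X <= _)%N]expn1 leq_exp2l.
move=> [i j] ij0; rewrite /e normc_real.
set x := enum_val i; set y := enum_val j.
have [k kP] : exists k, (x k, y k) != (0, 0).
  apply/existsP; apply: contraR ij0; rewrite negb_exists => /forallP xy.
  rewrite xpair_eqE -!(inj_eq enum_val_inj) !enum_rankK.
  by apply/andP; split; apply/eqP/ffunP => k; rewrite ffunE;
    have /negPn/eqP[] := xy k.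
have ev_le0 (s t : 'I_2) : qubit_eigval p q r s t <= 0.
  have [/eqP[-> ->]|st] := boolP ((s, t) == (0, 0)); first by rewrite /qubit_eigval.
  by rewrite (le_trans (qubit_eigval_le_gap st)) // oppr_le0 ltW // gap_gt0.
have sum_le : \sum_l qubit_eigval p q r (x l) (y l) <= - gap.
  rewrite (bigD1 k) //= -[leRHS]addr0 lerD ?qubit_eigval_le_gap //.
  by apply: sumr_le0.
have dV : 0 <= d%:R^-1 :> R by rewrite invr_ge0.
rewrite /ev normrM (ger0_norm dV) mulrC ler_wpM2l // ler0_norm ?sumr_le0 //.
by rewrite lerNr.
Qed.

End Spectrum.
End Hypercube.

Theorem theorem4p4 (R : realType) (beta : R) (hbeta : 0 < beta) :
  exists2 sigmaE : R, 0 < sigmaE &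
    (fun d : nat => spectral_gap (hypercube_lindbladian beta sigmaE d) : R^o)
      \is 'Omega_\oo (fun d : nat => (d%:R)^-1 : R^o).
Proof.
(* The choice 1 is arbitrary: [gap_gt0] and [hypercube_spectral_gap] hold for every positive energy
   resolution. The constant given next is [gap] at this resolution, which does not depend on [d]. *)
exists 1 => //; rewrite qualifE /=; apply/asboolP.
exists ((theta beta 1 2 2 + theta beta 1 (- 2) (- 2)) / 2 - theta beta 1 2 (- 2)).
  exact: gap_gt0 (ltW hbeta) ltr01.
near=> d; rewrite ger0_norm ?invr_ge0 //.
have d0 : (0 < d)%N by near: d; exact: nbhs_infty_gt.
apply: le_trans (hypercube_spectral_gap (ltW hbeta) ltr01 d0) (ler_norm _).
Unshelve. all: by end_near.
Qed.
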